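(* Let $m,n\geq1$, let $K_{m,n}$ be the complete bipartite graph with parts of sizes $m$ and $n$ and adjacency matrix $A_{K_{m,n}}$, let $k\geq1$ and $\tilde{A}_{K_{m,n}}=I_k\otimes A_{K_{m,n}}$. If $P$ is a permutation matrix of size $k(m+n)$ such that $\tilde{A}_{K_{m,n}}P\tilde{A}_{K_{m,n}}$ is symmetric, then there exists a symmetric permutation matrix $Q$ of size $k(m+n)$ such that $\tilde{A}_{K_{m,n}}P\tilde{A}_{K_{m,n}}=\tilde{A}_{K_{m,n}}Q\tilde{A}_{K_{m,n}}$. That is, every permutational $k$-th power of $K_{m,n}$ can be obtained by a classical zig-zag product.
   Context: The permutational $k$-th power of a graph $H$ with respect to a permutation with matrix $P$ is the graph with adjacency matrix $(I_k\otimes A_H)P(I_k\otimes A_H)$, defined when this matrix is symmetric; it is obtained by a classical zig-zag product when the same matrix arises from a symmetric permutation matrix. *)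

(* Defs.v *)
From mathcomp Require Import all_boot all_order all_algebra.
From mathcomp.real_closed Require Export mxtens.

Set Implicit Arguments.
Unset Strict Implicit.
Unset Printing Implicit Defensive.

Import GRing.Theory.
Local Open Scope ring_scope.

Definition adjacency_mx (R : pzRingType) (n : nat) (e : rel 'I_n) : 'M[R]_n :=
  \matrix_(i, j) (e i j)%:R.

(* The parts of K_{m,n} are the first m and the last n vertices. *)
Definition complete_bipartite (m n : nat) : rel 'I_(m + n) :=
  fun i j => (i < m)%N != (j < m)%N.

(* I_k (x) A : k disjoint copies, vertex v of copy c having index c * n + v. *)
Definition copies_mx (R : pzRingType) (k n : nat) (A : 'M[R]_n) :
    'M[R]_(k * n) :=
  (1%:M : 'M[R]_k) *t A.

(* For A the adjacency matrix of H, this is the adjacency matrix of the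
   permutational k-th power of H with respect to P, a graph only when the
   matrix is symmetric. It is a classical zig-zag product when P is moreover a
   symmetric permutation matrix. *)
Definition permutational_power_mx (R : pzRingType) (k n : nat)
    (A : 'M[R]_n) (P : 'M[R]_(k * n)) : 'M[R]_(k * n) :=
  copies_mx k A *m P *m copies_mx k A.

(* Main.v *)
Require Import Defs.
From mathcomp Require Import all_boot all_order all_algebra.
From mathcomp Require Import fingroup perm.

Set Implicit Arguments.
Unset Strict Implicit.
Unset Printing Implicit Defensive.

Import GRing.Theory Num.Theory.

(** Colour a vertex of the k copies of K_{m,n} by its copy and its side. An
entry of A P A then counts the vertices of one colour which the permutation
sends to another colour, so symmetry of A P A says that, for all colours i and
j, the set X_ij of vertices of colour i sent to colour j is equinumerous with
X_ji. The sets X_ij partition the vertices, and an involution exchanging X_ij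
with X_ji for all i, j has the same colour transition counts as P. *)

Section Transitions.

Variables (T C : finType) (c : T -> C).

Definition transition (s : T -> T) (i j : C) : {set T} :=
  [set u | (c u == i) && (c (s u) == j)].

Lemma in_transition (s : T -> T) (u : T) : u \in transition s (c u) (c (s u)).
Proof. by rewrite inE !eqxx. Qed.

Lemma involution_transition (s : T -> T) :
  (forall i j, #|transition s i j| = #|transition s j i|) ->
  exists2 t : T -> T, involutive t &
    forall i j, #|transition t i j| = #|transition s i j|.
Proof.
move=> symN.
(* The element of rank r in X_ij goes to the element of rank r in X_ji. The default [u] of [nth] is
   never reached, by [lt_index]. *)
pose t u := nth u (enum (transition s (c (s u)) (c u)))
                  (index u (enum (transition s (c u) (c (s u))))).
have lt_index u : index u (enum (transition s (c u) (c (s u))))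
    < size (enum (transition s (c (s u)) (c u))).
  by rewrite -cardE symN cardE index_mem mem_enum in_transition.
have t_in u : t u \in transition s (c (s u)) (c u).
  by rewrite -mem_enum; apply: mem_nth.
have c_t u : c (t u) = c (s u) by have := t_in u; rewrite inE => /andP[/eqP].
have c_st u : c (s (t u)) = c u.
  by have := t_in u; rewrite inE => /andP[_ /eqP].
exists t => [u | i j].
  rewrite {1}/t c_st c_t {2}/t index_uniq ?enum_uniq ?lt_index //.
  by rewrite nth_index // mem_enum in_transition.
(* Since [t u] and [s u] share a colour, the two transition sets even coincide. *)
by apply: eq_card => u; rewrite !inE c_t.
Qed.

End Transitions.

Local Open Scope ring_scope.

Section ColourMatrix.

Variables (R : numDomainType) (p : nat) (C : finType) (c : 'I_p -> C).
Variables (opp : C -> C) (A : 'M[R]_p).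
Hypothesis oppK : involutive opp.
Hypothesis AE : forall x y, A x y = (c y == opp (c x))%:R.

(** The entry is the sum over [u] of [A x u * A (s u) y], whose terms are 0 or 1; [oppK] turns the
    second factor into a condition on the colour of [s u]. *)
Lemma conj_perm_mxE (s : 'S_p) (x y : 'I_p) :
  (A *m perm_mx s *m A) x y = #|transition c s (opp (c x)) (opp (c y))|%:R.
Proof.
rewrite -mulmxA -row_permE mxE -sum1_card natr_sum [RHS]big_mkcond /=.
apply: eq_bigr => u _.
rewrite mxE !AE inE -natrM mulnb [c y == _]eq_sym (can2_eq oppK oppK).
by case: ifP.
Qed.

Lemma symmetric_conj_perm_mx (s : 'S_p) :
  (forall i, exists x, c x = i) ->
  (A *m perm_mx s *m A)^T = A *m perm_mx s *m A ->
  exists2 t : 'S_p, t^-1%g = t & A *m perm_mx s *m A = A *m perm_mx t *m A.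
Proof.
move=> c_surj symA.
have [i j|t tK tE] := @involution_transition _ _ c s.
  (* Surjectivity of [c] makes every transition count appear as an entry, and characteristic zero
     lets the counts be compared in [R]. *)
  have [[x cx] [y cy]] := (c_surj (opp i), c_surj (opp j)).
  have := congr1 (fun M : 'M_p => M y x) symA.
  by rewrite mxE !conj_perm_mxE cx cy !oppK => /eqP; rewrite eqr_nat => /eqP.
exists (perm (inv_inj tK)).
  apply/permP => x; apply: (@perm_inj _ (perm (inv_inj tK))).
  by rewrite permKV !permE tK.
apply/matrixP => x y; rewrite !conj_perm_mxE -tE; congr _%:R.
by apply: eq_card => u; rewrite !inE permE.
Qed.

End ColourMatrix.

Theorem theorem4p14 (R : numDomainType) (m n k : nat)
    (hm : (1 <= m)%N) (hn : (1 <= n)%N) (hk : (1 <= k)%N)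
    (P : 'M[R]_(k * (m + n))) :
  let A : 'M[R]_(m + n) := adjacency_mx R (@complete_bipartite m n) in
  is_perm_mx P ->
  (permutational_power_mx A P)^T = permutational_power_mx A P ->
  exists Q : 'M[R]_(k * (m + n)),
    [/\ is_perm_mx Q, Q^T = Q &
        permutational_power_mx A P = permutational_power_mx A Q].
Proof.
move=> A /is_perm_mxP[s ->{P}] symA.
pose c (x : 'I_(k * (m + n))) : 'I_k * bool :=
  ((mxtens_unindex x).1, ((mxtens_unindex x).2 < m)%N).
(* Two vertices are adjacent exactly when they lie in the same copy and on opposite sides. *)
pose opp (i : 'I_k * bool) := (i.1, ~~ i.2).
have oppK : involutive opp by case=> i b; rewrite /opp negbK.
have AE x y : copies_mx k A x y = (c y == opp (c x))%:R.
  rewrite !mxE -natrM mulnb eq_sym xpair_eqE /complete_bipartite /=.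
  by congr (_ && _)%:R; do 2!case: (_ < m)%N.
(* Both sides of each copy are nonempty, by [hm] and [hn]. *)
have c_surj i : exists x, c x = i.
  case: i => i [].
    exists (mxtens_index (i, lshift n (Ordinal hm))).
    by rewrite /c mxtens_indexK /= hm.
  exists (mxtens_index (i, rshift m (Ordinal hn))).
  by rewrite /c mxtens_indexK /= addn0 ltnn.
have [t tV tE] := symmetric_conj_perm_mx oppK AE c_surj symA.
by exists (perm_mx t); split; rewrite ?perm_mx_is_perm // tr_perm_mx tV.
Qed.
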